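(* The language $Q_I$ of ins-robust primitive words over $V$ is not regular.
   Context: $V$ is a finite alphabet with at least two distinct letters; $V^*$ is the set of all finite words over $V$. A nonempty word $w$ is primitive if it is not of the form $v^n$ for a word $v$ and an integer $n \ge 2$. For a word $w$ of length $n$, $w[1..i]$ denotes its prefix of length $i$ and $w[i+1..n]$ its suffix of length $n-i$. A primitive word $w$ of length $n$ is ins-robust if for every $i \in \{0,\ldots,n\}$ and every $a \in V$ the word $w[1..i]\,a\,w[i+1..n]$ is primitive; $Q_I$ is the set of ins-robust primitive words over $V$. *)

(* Defs.v *)
From HB Require Import structures.
From mathcomp Require Import all_boot.

Set Implicit Arguments.
Unset Strict Implicit.
Unset Printing Implicit Defensive.

Section Words.
Variable V : Type.

Definition word_pow (v : seq V) (n : nat) : seq V := flatten (nseq n v).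

Definition primitive (w : seq V) : Prop :=
  w <> [::] /\ ~ (exists (v : seq V) (n : nat), 2 <= n /\ w = word_pow v n).

(* [take i w] is w[1..i] and [drop i w] is w[i+1..n]. *)
Definition ins_robust (w : seq V) : Prop :=
  primitive w /\
  forall (i : nat) (a : V), i <= size w -> primitive (take i w ++ a :: drop i w).

Definition language := seq V -> Prop.

Definition QI : language := fun w => ins_robust w.

(* Complete deterministic finite automata; a language is regular when it is
   the set of words accepted by one of them. *)
Record dfa := Dfa {
  dfa_state : finType;
  dfa_start : dfa_state;
  dfa_trans : dfa_state -> V -> dfa_state;
  dfa_final : {set dfa_state}
}.

Definition dfa_accept (A : dfa) (w : seq V) : Prop :=
  foldl (@dfa_trans A) (dfa_start A) w \in dfa_final A.

Definition regular (L : language) : Prop :=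
  exists A : dfa, forall w : seq V, L w <-> dfa_accept A w.

End Words.

Arguments QI V : clear implicits.

(* Main.v *)
(** The words [a^m b] with [m = 1 mod 6] are pairwise inequivalent for the
    Myhill-Nerode relation of [Q_I]: [a^n b a^n b] is a square, whereas
    [a^m b a^n b] is ins-robust when [m < n].  Indeed an insertion leaves two or
    three letters [b] in a word of length [m + n + 3 = 5 mod 6], and the exponent
    of a power divides both its length and its number of [b]'s. *)

Require Import Defs.
From mathcomp Require Import all_boot zify.

Lemma pigeonhole_nat_finType (Q : finType) (f : nat -> Q) :
  exists s t, s < t /\ f s = f t.
Proof.
(* Restricted to one more argument than [Q] has elements, [f] cannot be injective. *)
pose g (i : 'I_#|Q|.+1) := f i.
have /injectivePn[i [j neq_ij eq_ij]] : ~~ injectiveb g.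
  by apply/injectiveP=> /leq_card; rewrite card_ord ltnn.
have [lt_ij|lt_ji|/val_inj eq_val] := ltngtP i j; last by rewrite eq_val eqxx in neq_ij.
- by exists i, j.
- by exists j, i.
Qed.

Section PrimitiveWords.
Variable V : eqType.
Implicit Types (v w : seq V) (x : V).

Lemma size_word_pow v k : size (word_pow v k) = k * size v.
Proof. by rewrite /word_pow size_flatten /shape map_nseq sumn_nseq mulnC. Qed.

Lemma count_mem_word_pow x v k :
  count_mem x (word_pow v k) = k * count_mem x v.
Proof. by rewrite /word_pow count_flatten map_nseq sumn_nseq mulnC. Qed.

Lemma primitive_coprime_count x w :
  w != [::] -> coprime (count_mem x w) (size w) -> primitive w.
Proof.
move=> /eqP w_neq0 co_w; split=> // -[v [k [k_gt1 def_w]]].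
move: co_w; rewrite def_w size_word_pow count_mem_word_pow.
(* Both products contain the factor [k], so [k] would be coprime to itself, forcing [k = 1]. *)
by rewrite coprimeMl => /andP[]; rewrite coprimeMr /coprime gcdnn => /andP[]; lia.
Qed.

Definition two_block_word (a b : V) m n : seq V :=
  (nseq m a ++ [:: b]) ++ (nseq n a ++ [:: b]).

Variables a b : V.
Hypothesis neq_ab : a != b.

Lemma size_two_block m n : size (two_block_word a b m n) = m + n + 2.
Proof. by rewrite !size_cat !size_nseq /=; lia. Qed.

Lemma count_two_block m n : count_mem b (two_block_word a b m n) = 2.
Proof. by rewrite !count_cat !count_nseq /= eqxx (negPf neq_ab); lia. Qed.

(** The default value [a] makes the formula valid beyond the end of the word too, so no bound on [i]
    is required. *)
Lemma nth_two_block m n i :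
  nth a (two_block_word a b m n) i = if (i == m) || (i == m + n + 1) then b else a.
Proof.
rewrite /two_block_word !nth_cat size_cat !size_nseq /= !nth_nseq !if_same.
case: ifP => [lt_i|ge_i].
  case: ifP => [lt_im|ge_im]; first by rewrite (_ : _ || _ = false) //; lia.
  have -> : i = m by lia.
  by rewrite eqxx subnn.
case: ifP => [lt_in|ge_in]; first by rewrite (_ : _ || _ = false) //; lia.
have [->|neq_i] := eqVneq i (m + n + 1).
  by rewrite orbT (_ : _ - _ - _ = 0) //; lia.
rewrite (_ : _ || _ = false); last by lia.
case def_j: (_ - _ - _) => [|j]; first by lia.
by rewrite /= nth_nil.
Qed.

Lemma two_block_neq0 m n : two_block_word a b m n <> [::].
Proof. by move/(congr1 size); rewrite size_two_block /=; lia. Qed.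

(** Coprimality is no help when [m + n] is even, as in the application. Instead, the two letters [b]
    force the exponent 2, and the halves of the word are compared. *)
Lemma primitive_two_block m n : m < n -> primitive (two_block_word a b m n).
Proof.
move=> lt_mn; split; first exact: two_block_neq0.
case=> v [k [k_gt1 def_w]].
have size_eq := size_two_block m n; have count_eq := count_two_block m n.
move: size_eq count_eq; rewrite {1 2}def_w size_word_pow count_mem_word_pow.
move=> size_eq count_eq.
have k_dvd2 : k %| 2 by rewrite -count_eq dvdn_mulr.
have k_eq2 : k = 2 by have := @dvdn_leq k 2 isT k_dvd2; lia.
subst k; have lt_mv : m < size v by lia.
have nth_vv i : i < size v ->
    nth a (two_block_word a b m n) (size v + i) = nth a (two_block_word a b m n) i.
  move=> lt_iv; rewrite def_w /word_pow /= cats0 !nth_cat lt_iv.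
  by rewrite addKn ifN //; lia.
(* The [b] at position [m] recurs at [size v + m]. This would have to be the last position
   [m + n + 1], but [2 * size v = m + n + 2] then gives [m = n]. *)
have := nth_vv m lt_mv; rewrite !nth_two_block eqxx /=.
rewrite ifN; last by lia.
by move/eqP; rewrite (negPf neq_ab).
Qed.

Lemma ins_robust_two_block m n :
  m < n -> m %% 6 = 1 -> n %% 6 = 1 -> ins_robust (two_block_word a b m n).
Proof.
move=> lt_mn m_mod6 n_mod6; split; first exact: primitive_two_block.
move=> i c le_i; set w := two_block_word a b m n in le_i *.
have size_w : size (take i w ++ c :: drop i w) = m + n + 3.
  have := congr1 size (cat_take_drop i w).
  by rewrite size_two_block !size_cat /=; lia.
(* The place of insertion is irrelevant, and of the letter [c] only whether it is [b] matters. *)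
have count_w : count_mem b (take i w ++ c :: drop i w) = 2 + (c == b).
  have := congr1 (count_mem b) (cat_take_drop i w).
  by rewrite count_two_block !count_cat /=; lia.
apply: (@primitive_coprime_count b); first by rewrite -size_eq0 size_w; lia.
rewrite count_w size_w; case: (c == b).
  by rewrite prime_coprime //; lia.
by rewrite prime_coprime //; lia.
Qed.

Lemma not_ins_robust_two_block n : ~ ins_robust (two_block_word a b n n).
Proof.
case=> -[_ prim_w] _; apply: prim_w; exists (nseq n a ++ [:: b]), 2; split=> //.
by rewrite /word_pow /= cats0.
Qed.

End PrimitiveWords.

Theorem theorem20 (V : finType) (hV : 1 < #|V|) : ~ regular (QI V).
Proof.
case=> A accA; have /card_gt1P[a [b [_ _ neq_ab]]] := hV.
pose block t := nseq (6 * t + 1) a ++ [:: b].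
have [s [t [lt_st eq_st]]] :=
  pigeonhole_nat_finType _ (fun t => foldl (@dfa_trans _ A) (dfa_start A) (block t)).
apply: (@not_ins_robust_two_block _ a b (6 * t + 1)); apply/accA.
(* [block s] and [block t] lead to the same state, so the first [block t] of the square can be
   replaced by [block s]. *)
rewrite /dfa_accept /two_block_word foldl_cat -/(block t) -eq_st -foldl_cat.
by apply/accA/ins_robust_two_block => //; lia.
Qed.
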